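(* Let $0<q<1$, let $m\in\mathbb{N}$ (so $m\ge 1$) and let $s_1,\dots,s_m\in\mathbb{N}_0$. Then $$\zeta_q^*[\{2\}^{s_1},1,\{2\}^{s_2},1,\dots,\{2\}^{s_m},1]=\sum_{\mathbf{p}=(2s_1+1)\circ(2s_2+1)\circ\cdots\circ(2s_m+1)}\hat{\mathfrak{z}}_q[\mathbf{p};\tilde{\mathbf{p}}],$$ where the sum runs over all $2^{m-1}$ choices of each symbol $\circ$ as either ''comma'' or ''plus'', and for each such choice $\tilde{\mathbf{p}}:=(s_1+1)\circ(s_2+1)\circ\cdots\circ(s_m+1)$ is formed with exactly the same choice of commas and pluses as $\mathbf{p}$.
   Context: $[n]_q=\frac{1-q^n}{1-q}=\sum_{k=0}^{n-1}q^k$. $\{2\}^a$ denotes the string $2,\dots,2$ ($a$ times; empty if $a=0$). For positive integers $s_1,\dots,s_r$ (with the terms below), $\zeta_q^*[s_1,\dots,s_r]=\sum_{k_1\ge k_2\ge\cdots\ge k_r\ge1}\prod_{j=1}^r\frac{q^{k_j}}{[k_j]_q^{s_j}}$. For integer tuples $\mathbf{s}=(s_1,\dots,s_r)$, $\mathbf{t}=(t_1,\dots,t_r)$ and $n\ge0$, $\mathcal{H}_n[\mathbf{s};\mathbf{t}]=\sum_{n\ge k_1>k_2>\cdots>k_r\ge1}\prod_{j=1}^r\frac{q^{(t_j-1)k_j}(1+q^{k_j})}{[k_j]_q^{s_j}}$ (equal to $0$ if $n<r$, and equal to $1$ when $r=0$), and $\hat{\mathfrak{z}}_q[\mathbf{s};\mathbf{t}]=\sum_{k=1}^\infty\frac{q^{k^2+(t_1-1)k}(1+q^k)}{[k]_q^{s_1}}\mathcal{H}_{k-1}[s_2,\dots,s_r;t_2,\dots,t_r]$.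 A string $a_1\circ a_2\circ\cdots\circ a_m$ with each $\circ$ a comma or a plus denotes the tuple obtained by adding together consecutive entries joined by a plus and separating entries joined by a comma (e.g. $3\circ5\circ1$ with choices (plus, comma) gives $(8,1)$). *)

(* Defs.v *)
From mathcomp Require Import all_boot all_order all_algebra.
From mathcomp Require Import all_classical all_reals all_analysis.

Set Implicit Arguments.
Unset Strict Implicit.
Unset Printing Implicit Defensive.

Import Order.TTheory GRing.Theory Num.Theory.
Local Open Scope ring_scope.
Local Open Scope classical_set_scope.

Definition qint (R : realType) (q : R) (n : nat) : R := (1 - q ^+ n) / (1 - q).

(* The sum is the unordered sum in [0, +oo] over the r-tuples
   k_1 >= k_2 >= ... >= k_r >= 1; its terms are nonnegative for 0 < q < 1. *)
Definition zeta_star (R : realType) (q : R) (s : seq nat) : \bar R :=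
  (\esum_(k in [set k : (size s).-tuple nat |
                 sorted geq k && all (leq 1) k])
    (\prod_(j < size s) (q ^+ tnth k j / qint q (tnth k j) ^+ nth 0%N s j))%:E)%E.

(* Here s and t are meant to have the same length. *)
Definition H (R : realType) (q : R) (n : nat) (s t : seq int) : R :=
  \sum_(k : (size s).-tuple 'I_n.+1 |
         sorted gtn (map val k) && all (leq 1) (map val k))
    \prod_(j < size s)
      (q ^ ((nth 0 t j - 1) * (tnth k j)%:Z) * (1 + q ^+ tnth k j)
        / qint q (tnth k j) ^ nth 0 s j).

(* Here s and t are meant to be nonempty, of the same length; the outer series
   is a limit in the extended reals, of partial sums that are nondecreasing
   for 0 < q < 1. *)
Definition zhat (R : realType) (q : R) (s t : seq int) : \bar R :=
  (\sum_(1 <= k <oo)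
    (q ^ ((k ^ 2)%N%:Z + (head 0 t - 1) * k%:Z) * (1 + q ^+ k)
      / qint q k ^ head 0 s * H q k.-1 (behead s) (behead t))%R%:E)%E.

Fixpoint circ_from (x : int) (cs : seq (bool * int)) : seq int :=
  match cs with
  | [::] => [:: x]
  | (plus, y) :: cs' =>
      if plus then circ_from (x + y) cs' else x :: circ_from y cs'
  end.

(* The tuple denoted by a_1 o a_2 o ... o a_m, where the i-th symbol o is a plus
   if the i-th entry of c is true and a comma if it is false. *)
Definition circ (c : seq bool) (a : seq int) : seq int :=
  if a is x :: a' then circ_from x (zip c a') else [::].

(* Main.v *)
(* Put A_n(k) = ((q)_n)^2 / ((q)_(n-k) (q)_(n+k)), with (q)_n the q-factorial
   (1 - q) ... (1 - q^n), and T_n f = sum_(k <= n) A_n(k) q^(k^2) f(k).  The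
   truncated star sum S_n(w), in which k_1 <= n, equals T_n f_w for an explicit
   f_w: the empty word gives the indicator of 0, prepending a 2 multiplies f_w
   by q^k / [k]^2, and prepending a 1 replaces f_w(k) by
     q^k / [k] f_w(k) + (1 + q^k) / [k] sum_(j < k) f_w(j).
   Both rules follow by comparing increments in n, using
     A_(n+1)(k) - A_n(k) = q^(n+1-k) [k]^2 / [n+1]^2 A_(n+1)(k),
   and for the 1 also summation by parts and a telescoping sum.  The two summands
   of the rule for 1 are the choices "plus" and "comma", so f_w unfolds into the
   sum over all choices.  Finally 0 <= A_n(k) <= 1 and A_n(k) -> 1, which lets n
   tend to infinity. *)
Require Import Defs.
From mathcomp Require Import all_boot all_order all_algebra.
From mathcomp Require Import all_classical all_reals all_analysis.
From mathcomp Require Import ring zify.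

Set Implicit Arguments.
Unset Strict Implicit.
Unset Printing Implicit Defensive.

Import Order.TTheory GRing.Theory Num.Theory.
Import numFieldNormedType.Exports.
Local Open Scope ring_scope.
Local Open Scope classical_set_scope.

(** * Iterated form of sums over monotone tuples *)

Lemma big_tuple_cons (V : nmodType) (T : finType) r (P : pred (r.+1.-tuple T))
    (F : r.+1.-tuple T -> V) :
  \sum_(k : r.+1.-tuple T | P k) F k =
  \sum_(x : T) \sum_(t : r.-tuple T | P [tuple of x :: t]) F [tuple of x :: t].
Proof.
rewrite pair_big_dep /=.
rewrite (reindex (fun p : T * r.-tuple T => [tuple of p.1 :: p.2])) //=.
exists (fun k => (thead k, [tuple of behead k])).
  by move=> [x t] _ /=; congr pair; apply/val_inj.
by move=> k _; rewrite [RHS]tuple_eta; apply/val_inj.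
Qed.

(* Peels off the first entry; the order and bound constraints on the rest are
   kept as a predicate so that the statement can be iterated. *)
Lemma sorted_tuple_sumS (V : comPzRingType) (e : rel nat) (e_tr : transitive e)
    N (F : nat -> nat -> V) r (P : pred nat) :
  \sum_(k : r.+1.-tuple 'I_N | sorted e (map val k) && all P (map val k))
     \prod_(i < r.+1) F i (tnth k i) =
  \sum_(j < N | P j) F 0%N j *
    \sum_(k : r.-tuple 'I_N | sorted e (map val k)
                       && all [pred x | P x && e j x] (map val k))
       \prod_(i < r) F i.+1 (tnth k i).
Proof.
rewrite big_tuple_cons [RHS]big_mkcond /=; apply: eq_bigr => j _.
case: ifPn => Pj; last first.
  by rewrite big_pred0 // => t /=; rewrite andbF.
rewrite mulr_sumr /=; apply: eq_big => [t|t _].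
  by rewrite path_sortedE // (all_predI P (e j)) andbC andbA andbC.
rewrite big_ord_recl /= (tnth_nth j) /=; congr (_ * _).
by apply: eq_bigr => i _; rewrite !(tnth_nth j).
Qed.

Section QSums.
Context (R : realType) (q : R).
Implicit Types (n k : nat) (f : nat -> R) (s w : seq nat) (u v : seq int).

Fixpoint star_sum n w : R :=
  if w is a :: w' then
    \sum_(1 <= j < n.+1) q ^+ j / qint q j ^+ a * star_sum j w'
  else 1.

Fixpoint strict_sum n u v : R :=
  if u is a :: u' then
    \sum_(1 <= j < n) q ^ ((head 0 v - 1) * j%:Z) * (1 + q ^+ j)
        / qint q j ^ a * strict_sum j u' (behead v)
  else 1.

Lemma big_nat1_ord N b (G : nat -> R) : (b <= N)%N ->
  \sum_(1 <= j < b) G j = \sum_(j < N | (1 <= j < b)%N) G j.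
Proof.
move=> bN; rewrite -(big_mkord (fun j => 1 <= j < b)%N G).
rewrite [LHS]big_nat [LHS](big_nat_widenl 1 0) //.
rewrite (big_nat_widen 0 b N) //.
by apply: eq_bigl => i; lia.
Qed.

(** The ordinal type ['I_N] stays fixed through the induction while the bound [n] drops to the entry
    just peeled off, hence the two separate parameters. *)
Lemma strict_sumE N n u v : (n <= N)%N ->
  \sum_(k : (size u).-tuple 'I_N |
         sorted gtn (map val k) && all [pred x | 1 <= x < n]%N (map val k))
    \prod_(j < size u)
      (q ^ ((nth 0 v j - 1) * (tnth k j)%:Z) * (1 + q ^+ tnth k j)
        / qint q (tnth k j) ^ nth 0 u j) = strict_sum n u v.
Proof.
elim: u v n => [|a u IH] v n nN /=.
  rewrite (big_pred1 [tuple]) ?big_ord0 // => t.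
  by rewrite tuple0 /= eqxx.
pose F i (x : nat) := q ^ ((nth 0 v i - 1) * x%:Z) * (1 + q ^+ x)
        / qint q x ^ nth 0 (a :: u) i.
rewrite (@sorted_tuple_sumS _ gtn _ _ F); last by move=> x y z; rewrite /gtn/=; lia.
rewrite (big_nat1_ord _ nN); apply: eq_bigr => j /andP[j1 jn].
rewrite {1}/F /= -nth0; congr (_ * _).
rewrite -IH ?(ltnW (leq_trans jn _)) //; apply: eq_big => [k|k _].
  by congr andb; apply: eq_all => x /=; lia.
by apply: eq_bigr => i _; rewrite /F /= nth_behead.
Qed.

Lemma H_strict_sum n u v : H q n u v = strict_sum n.+1 u v.
Proof.
rewrite -(strict_sumE u v (leqnn n.+1)); apply: eq_bigl => k; congr andb.
by apply: eq_in_all => x /mapP[y _ ->] /=; rewrite ltn_ord andbT.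
Qed.

Lemma star_sumE N n w : (n < N)%N ->
  \sum_(k : (size w).-tuple 'I_N |
         sorted geq (map val k) && all [pred x | 1 <= x <= n]%N (map val k))
    \prod_(j < size w) (q ^+ tnth k j / qint q (tnth k j) ^+ nth 0%N w j)
  = star_sum n w.
Proof.
elim: w n => [|a w IH] n nN /=.
  rewrite (big_pred1 [tuple]) ?big_ord0 // => t.
  by rewrite tuple0 /= eqxx.
pose F i (x : nat) := q ^+ x / qint q x ^+ nth 0%N (a :: w) i.
rewrite (@sorted_tuple_sumS _ geq _ _ F); last by move=> x y z; rewrite /geq/=; lia.
rewrite (big_nat1_ord _ nN); apply: eq_bigr => j /andP[j1 jn].
rewrite {1}/F /=; congr (_ * _).
rewrite -IH ?(leq_trans jn) //; apply: eq_bigl => k.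
by congr andb; apply: eq_all => x /=; lia.
Qed.

(** * Positivity, and the weights A_n(k) as [n] grows *)

Hypotheses (q_gt0 : 0 < q) (q_lt1 : q < 1).

Lemma subr_q_gt0 : 0 < 1 - q.
Proof. by rewrite subr_gt0. Qed.

Lemma subr_expq_gt0 k : 0 < 1 - q ^+ k.+1.
Proof. by rewrite subr_gt0 exprn_ilt1 // ltW. Qed.

Lemma qint0 : qint q 0 = 0.
Proof. by rewrite /qint expr0 subrr mul0r. Qed.

Lemma qint_gt0 k : (0 < k)%N -> 0 < qint q k.
Proof. by case: k => // k _; rewrite divr_gt0 ?subr_expq_gt0 ?subr_q_gt0. Qed.

(* A_n(k); for k > n the truncated factor 1 - q^(n - n) makes it 0. *)
Definition qratio n k : R :=
  \prod_(i < k) ((1 - q ^+ (n - i)) / (1 - q ^+ (n + i.+1))).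

Lemma qratio0 n : qratio n 0 = 1.
Proof. by rewrite /qratio big_ord0. Qed.

Lemma qratioS n k : qratio n k.+1 =
  qratio n k * ((1 - q ^+ (n - k)) / (1 - q ^+ (n + k.+1))).
Proof. by rewrite /qratio big_ord_recr. Qed.

Lemma qratio_oversize n : qratio n n.+1 = 0.
Proof. by rewrite qratioS subnn subrr mul0r mulr0. Qed.

(** Cross-multiplied quotient of consecutive weights. In this form it also covers [k = n.+1], where
    both sides are 0. *)
Lemma qratio_succ n k : (k <= n.+1)%N ->
  qratio n k * (1 - q ^+ n.+1) ^+ 2 =
  qratio n.+1 k * (1 - q ^+ (n.+1 - k)) * (1 - q ^+ (n.+1 + k)).
Proof.
elim: k => [|k IH] kn; first by rewrite !qratio0 subn0 addn0; ring.
have {}IH := IH (ltnW kn).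
rewrite addSnnS in IH; rewrite !qratioS subSS !addSnnS.
have : 0 < 1 - q ^+ (n + k.+1) by rewrite addnS subr_expq_gt0.
have : 0 < 1 - q ^+ (n + k.+2) by rewrite addnS subr_expq_gt0.
move: (1 - q ^+ (n + k.+1)) (1 - q ^+ (n + k.+2)) IH => a b IH b0 a0.
have -> : qratio n k * ((1 - q ^+ (n - k)) / a) * (1 - q ^+ n.+1) ^+ 2 =
  (qratio n k * (1 - q ^+ n.+1) ^+ 2) * (1 - q ^+ (n - k)) / a by ring.
by rewrite IH; field; rewrite !gt_eqF.
Qed.

(** With x = q^k and y = q^(n+1-k), [qratio_succ] reduces this to (1 - yx)^2 - (1 - y)(1 - yx^2) =
    y(1 - x)^2. *)
Lemma qratio_diff n k : (k <= n.+1)%N ->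
  qratio n.+1 k - qratio n k =
  q ^+ n.+1 * qint q k ^+ 2 / (qint q n.+1 ^+ 2 * q ^+ k) * qratio n.+1 k.
Proof.
move=> kn; have := qratio_succ kn.
have : 1 - q ^+ n.+1 != 0 by rewrite gt_eqF ?subr_expq_gt0.
have : 1 - q != 0 by rewrite gt_eqF ?subr_q_gt0.
have : q ^+ k != 0 by rewrite gt_eqF ?exprn_gt0.
have xy : q ^+ n.+1 = q ^+ (n.+1 - k) * q ^+ k by rewrite -exprD subnK.
rewrite /qint exprD xy.
move: (qratio n k) (qratio n.+1 k) (q ^+ k) (q ^+ (n.+1 - k)) => A B x y.
move=> x0 q0 N0 E.
have -> : A = B * (1 - y) * (1 - y * x * x) / (1 - y * x) ^+ 2.
  by rewrite -E mulfK // expf_neq0.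
by field; rewrite q0 N0 x0.
Qed.

(** * The transform T_n and the two prepending rules *)

Definition qratio_sum n f := \sum_(k < n.+1) qratio n k * q ^+ (k ^ 2) * f k.

Lemma qratio_sum_widen n f :
  qratio_sum n f = \sum_(k < n.+2) qratio n k * q ^+ (k ^ 2) * f k.
Proof. by rewrite big_ord_recr /= qratio_oversize !mul0r addr0. Qed.

Lemma qratio_sum0 f : qratio_sum 0 f = f 0%N.
Proof. by rewrite /qratio_sum big_ord1 qratio0 expr0 !mul1r. Qed.

Definition prepend1 f k :=
  q ^+ k / qint q k * f k + (1 + q ^+ k) / qint q k * \sum_(j < k) f j.

(** Termwise, the factor [k]^2 / q^k of [qratio_diff] cancels the one put in front of [f]. At
    [k = 0] there is nothing to cancel, as [0] = 0, and [f 0 = 0] takes over. *)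
Lemma qratio_sum_prepend2 n f : f 0%N = 0 ->
  qratio_sum n.+1 (fun k => q ^+ k / qint q k ^+ 2 * f k) =
  qratio_sum n (fun k => q ^+ k / qint q k ^+ 2 * f k)
    + q ^+ n.+1 / qint q n.+1 ^+ 2 * qratio_sum n.+1 f.
Proof.
move=> f0; rewrite [in RHS]qratio_sum_widen /qratio_sum mulr_sumr -big_split /=.
apply: eq_bigr => -[[|k] kn] _ /=; first by rewrite f0; ring.
have kn' : (k.+1 <= n.+1)%N by [].
rewrite -[qratio n k.+1](subKr (qratio n.+1 k.+1)) (qratio_diff kn').
have : qint q k.+1 != 0 by rewrite gt_eqF ?qint_gt0.
have : qint q n.+1 != 0 by rewrite gt_eqF ?qint_gt0.
have : q ^+ k.+1 != 0 by rewrite gt_eqF ?exprn_gt0.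
move: (qint _ k.+1) (qint _ n.+1) (q ^+ k.+1) (q ^+ n.+1) => a b x y ? ? ?.
by field; apply/and3P; split.
Qed.

(* Equal to [sum_(k < i <= n) q^(i^2 - i) [i] (1 + q^i) A_n(i)], see
   [qratio_tail_diff]. *)
Definition qratio_tail n k := q ^+ (k ^ 2) * qratio n k * (qint q n - qint q k).

Lemma qratio_tail_diff n k : (k < n)%N -> qratio_tail n k - qratio_tail n k.+1 =
  q ^+ (k ^ 2 + k) * qint q k.+1 * (1 + q ^+ k.+1) * qratio n k.+1.
Proof.
move=> kn; rewrite /qratio_tail /qint qratioS.
have -> : (k.+1 ^ 2 = k ^ 2 + k + k.+1)%N by lia.
have := subr_expq_gt0 (n + k); rewrite -addnS !exprD !exprS.
have -> : q ^+ n = q ^+ k * q ^+ (n - k) by rewrite -exprD subnKC // ltnW.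
have := subr_q_gt0.
move: (q ^+ (k ^ 2)) (q ^+ k) (q ^+ (n - k)) (qratio n k) => c x y A a0 b0.
by field; rewrite !gt_eqF //; move: b0; rewrite -!mulrA.
Qed.

(** Writes the part of the increment that carries the inner sum as a difference of tails times a
    partial sum of [f], ready for summation by parts. *)
Lemma qratio_diff_prepend1 n k f : (k < n.+1)%N ->
  (qratio n.+1 k.+1 - qratio n k.+1) * q ^+ (k.+1 ^ 2) * prepend1 f k.+1 =
  q ^+ n.+1 / qint q n.+1 ^+ 2 *
   (q ^+ (k.+1 ^ 2) * qratio n.+1 k.+1 * qint q k.+1 * f k.+1
    + (qratio_tail n.+1 k - qratio_tail n.+1 k.+1) * \sum_(j < k.+1) f j).
Proof.
move=> kn; rewrite qratio_diff // qratio_tail_diff // /prepend1.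
have -> : (k.+1 ^ 2 = k ^ 2 + k + k.+1)%N by lia.
rewrite (exprD _ _ k.+1).
have : qint q k.+1 != 0 by rewrite gt_eqF ?qint_gt0.
have : qint q n.+1 != 0 by rewrite gt_eqF ?qint_gt0.
have : q ^+ k.+1 != 0 by rewrite gt_eqF ?exprn_gt0.
move: (qint _ k.+1) (qint _ n.+1) (q ^+ k.+1) (q ^+ n.+1) => a b x y ? ? ?.
by field; apply/and3P; split.
Qed.

(** Summation by parts, with the upper end [K] free so that induction applies. The boundary term
    vanishes at [K = n.+1]. *)
Lemma sum_qratio_diff_prepend1 n f K : (K <= n.+1)%N ->
  \sum_(k < K.+1) (qratio n.+1 k - qratio n k) * q ^+ (k ^ 2) * prepend1 f k =
  q ^+ n.+1 / qint q n.+1 ^+ 2 *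
   (\sum_(k < K.+1) q ^+ (k ^ 2) * qratio n.+1 k * qint q k * f k
    + \sum_(k < K) qratio_tail n.+1 k * f k - qratio_tail n.+1 K * \sum_(k < K) f k).
Proof.
elim: K => [|K IH] Kn.
  by rewrite !big_ord1 !big_ord0 !qratio0 qint0; ring.
rewrite big_ord_recr /= (IH (ltnW Kn)) (qratio_diff_prepend1 f Kn).
rewrite [\sum_(k < K.+2) _]big_ord_recr /=.
rewrite [\sum_(k < K.+1) qratio_tail _ _ * _]big_ord_recr /=.
rewrite [\sum_(k < K.+1) f k]big_ord_recr /=.
by move: (q ^+ (K.+1 ^ 2)) (qratio_tail n.+1 K.+1) => c t; ring.
Qed.

Lemma qratio_sum_prepend1 n f :
  qratio_sum n.+1 (prepend1 f) =
  qratio_sum n (prepend1 f) + q ^+ n.+1 / qint q n.+1 ^+ 1 * qratio_sum n.+1 f.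
Proof.
apply/eqP; rewrite addrC -subr_eq [in X in _ - X]qratio_sum_widen /qratio_sum -sumrB.
under eq_bigr do rewrite -!mulrBl.
rewrite sum_qratio_diff_prepend1 //; set t := qratio_tail _ _.
have -> : t = 0 by rewrite /t /qratio_tail subrr mulr0.
rewrite mul0r subr0.
have -> : \sum_(k < n.+1) qratio_tail n.+1 k * f k =
    \sum_(k < n.+2) qratio_tail n.+1 k * f k.
  by rewrite [RHS]big_ord_recr /= -/t /t /qratio_tail subrr mulr0 mul0r addr0.
(* The coefficients [k] and [n+1] - [k] of [f k] add up to [n+1], which cancels one of the two
   factors [n+1] in the denominator. *)
rewrite -big_split /= !mulr_sumr; apply/eqP; apply: eq_bigr => k _.
have : qint q n.+1 != 0 by rewrite gt_eqF ?qint_gt0.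
rewrite /qratio_tail; move: (qint _ n.+1) => b ?.
by field.
Qed.

(* Since 1 / [0] = 0 in Rocq, the value at [k = 0] is 0 unless [s] is empty, as
   required for the inner sums over [j < k] to start effectively at 1. *)
Fixpoint zhat_coef s : nat -> R :=
  if s is x :: s' then
    fun k => (q ^+ k / qint q k ^+ 2) ^+ x * prepend1 (zhat_coef s') k
  else fun k => (k == 0)%:R.

(** * Truncated star sums as transforms *)

Lemma prepend1_0 f : prepend1 f 0 = 0.
Proof. by rewrite /prepend1 qint0 invr0 !mulr0 !mul0r addr0. Qed.

Lemma zhat_coef_cons0 x s : zhat_coef (x :: s) 0 = 0.
Proof. by rewrite /= prepend1_0 mulr0. Qed.

(** Both sides vanish at [n = 0] and have the same increments in [n]. *)
Lemma star_sum_cons_qratio_sum a w f g :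
  (forall n, star_sum n w = qratio_sum n f) -> g 0%N = 0 ->
  (forall n, qratio_sum n.+1 g = qratio_sum n g +
     q ^+ n.+1 / qint q n.+1 ^+ a * qratio_sum n.+1 f) ->
  forall n, star_sum n (a :: w) = qratio_sum n g.
Proof.
move=> wf g0 gS; elim=> [|n IH]; first by rewrite /= qratio_sum0 big_geq.
by rewrite /= big_nat_recr //= -/(star_sum n (a :: w)) IH gS wf.
Qed.

Lemma star_sum_block_qratio_sum x w f : (forall n, star_sum n w = qratio_sum n f) ->
  forall n, star_sum n (nseq x 2%N ++ 1%N :: w) =
            qratio_sum n (fun k => (q ^+ k / qint q k ^+ 2) ^+ x * prepend1 f k).
Proof.
move=> wf; elim: x => [|x IH].
  rewrite (_ : (fun k => _) = prepend1 f).
    by apply: star_sum_cons_qratio_sum wf (prepend1_0 f) _ => n;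
      apply: qratio_sum_prepend1.
  by apply/funext => k; rewrite mul1r.
pose g k := (q ^+ k / qint q k ^+ 2) ^+ x * prepend1 f k.
rewrite (_ : (fun k => _) = fun k => q ^+ k / qint q k ^+ 2 * g k).
  have g0 : g 0%N = 0 by rewrite /g prepend1_0 mulr0.
  apply: star_sum_cons_qratio_sum IH _ _; first by rewrite -/(g 0%N) g0 mulr0.
  by move=> n; apply: qratio_sum_prepend2.
by apply/funext => k; rewrite /g mulrA -exprS.
Qed.

Lemma star_sum_qratio_sum s n :
  star_sum n (flatten [seq rcons (nseq i 2%N) 1%N | i <- s]) =
  qratio_sum n (zhat_coef s).
Proof.
elim: s n => [|x s IH] n; last by rewrite /= cat_rcons; apply: star_sum_block_qratio_sum.
(* For the empty word only [k = 0] survives, with weight A_n(0) = 1. *)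
rewrite /qratio_sum big_ord_recl qratio0 expr0 !mul1r big1 ?addr0 // => i _.
by rewrite mulr0.
Qed.

(** * Unfolding the coefficients into choices of commas and pluses *)

(** The summand of [zhat] without q^(k^2). That factor belongs to the outermost index only, so
    without it the inner strict sums are built from the same terms. *)
Definition zhat_term k u v :=
  q ^ ((head 0 v - 1) * k%:Z) * (1 + q ^+ k)
    / qint q k ^ head 0 u * strict_sum k (behead u) (behead v).

(** Makes a leading plus act on the head alone, whatever the later symbols are. *)
Lemma circ_from_add (x y : int) cs :
  circ_from (x + y) cs = (x + head 0 (circ_from y cs)) :: behead (circ_from y cs).
Proof. by elim: cs y => //= -[[] z] cs IH y //=; rewrite -addrA IH. Qed.

Lemma big_tuple_bool m (F : m.+1.-tuple bool -> R) :
  \sum_c F c = \sum_(c : m.-tuple bool) F [tuple of true :: c]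
             + \sum_(c : m.-tuple bool) F [tuple of false :: c].
Proof. by rewrite big_tuple_cons big_bool. Qed.

Lemma strict_sum_zhat_term k u v : u != [::] ->
  strict_sum k u v = \sum_(1 <= j < k) zhat_term j u v.
Proof. by case: u. Qed.

Lemma circ_neq0 c x u : circ c (x :: u) != [::].
Proof.
rewrite /circ; elim: (zip c u) x => //= -[[] y] l IH x //; exact: IH.
Qed.

Lemma zhat_term_plus x k u v : (0 < k)%N ->
  zhat_term k ((2 * x + 1)%N%:Z + head 0 u :: behead u)
          ((x + 1)%N%:Z + head 0 v :: behead v) =
  (q ^+ k / qint q k ^+ 2) ^+ x * (q ^+ k / qint q k) * zhat_term k u v.
Proof.
move=> k0; have Q0 : qint q k != 0 by rewrite gt_eqF ?qint_gt0.
have q0 : q != 0 by rewrite gt_eqF.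
rewrite /zhat_term /= -addrA mulrDl !expfzDr // -PoszM -!exprnP.
rewrite [((x + 1) * k)%N]mulnC [q ^+ (k * _)]exprM (exprD _ x) (exprD _ (2 * x)).
rewrite !expr1 (exprM _ 2).
move: (qint q k) (q ^+ k) Q0 => a y a0.
have : a ^ head 0 u != 0 by rewrite expfz_neq0.
have : (a ^+ 2) ^+ x != 0 by rewrite !expf_neq0.
rewrite expr_div_n; move: (a ^ _) ((a ^+ 2) ^+ x) (y ^+ x) (q ^ _) => b c d e.
by move=> ? ?; field; apply/and3P; split.
Qed.

Lemma zhat_term_comma x k u v : (0 < k)%N ->
  zhat_term k ((2 * x + 1)%N%:Z :: u) ((x + 1)%N%:Z :: v) =
  (q ^+ k / qint q k ^+ 2) ^+ x * ((1 + q ^+ k) / qint q k * strict_sum k u v).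
Proof.
move=> k0; have Q0 : qint q k != 0 by rewrite gt_eqF ?qint_gt0.
rewrite /zhat_term /= PoszD addrK -PoszM -!exprnP.
rewrite [(x * k)%N]mulnC [q ^+ (k * _)]exprM (exprD _ (2 * x)) expr1 (exprM _ 2).
move: (qint q k) (q ^+ k) Q0 => a y a0.
have : (a ^+ 2) ^+ x != 0 by rewrite !expf_neq0.
rewrite expr_div_n; move: ((a ^+ 2) ^+ x) (y ^+ x) => c d c0.
by field; apply/andP; split.
Qed.

Lemma sum_nat1_ord k f : f 0%N = 0 -> \sum_(1 <= j < k) f j = \sum_(j < k) f j.
Proof.
move=> f0; rewrite -(big_mkord xpredT); case: k => [|k]; first by rewrite !big_geq.
by rewrite [RHS]big_nat_recl // f0 add0r big_add1.
Qed.

(** Induction on [s], splitting on the first symbol: plus matches the first summand of [prepend1],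
    comma the second. *)
Lemma zhat_coefE x s k : (0 < k)%N -> zhat_coef (x :: s) k =
  \sum_(c : (size s).-tuple bool)
    zhat_term k (circ c [seq (2 * i + 1)%N%:Z | i <- x :: s])
            (circ c [seq (i + 1)%N%:Z | i <- x :: s]).
Proof.
elim: s x k => [|y s IH] x k k0.
  rewrite (big_pred1 [tuple]) => [|t]; last by symmetry; apply/eqP; exact: tuple0.
  rewrite [circ _ _]/= zhat_term_comma //= /prepend1; congr (_ * _).
  (* The indicator of 0 vanishes at [k] itself and contributes 1 to the sum over [j < k], both
     because [k > 0]. *)
  by rewrite -(prednK k0) big_ord_recl big1 //= mulr0 add0r addr0 mulr1.
rewrite big_tuple_bool.
transitivity ((q ^+ k / qint q k ^+ 2) ^+ x * prepend1 (zhat_coef (y :: s)) k);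
  first by [].
rewrite /prepend1 mulrDr IH //; congr (_ + _).
  rewrite mulrA mulr_sumr; apply: eq_bigr => c _.
  by rewrite /circ /= !circ_from_add zhat_term_plus.
(* The term [j = 0] is dropped first, since the induction hypothesis needs a positive index. *)
rewrite -sum_nat1_ord ?zhat_coef_cons0 //.
under eq_big_nat => j /andP[j0 _] do rewrite IH //.
rewrite exchange_big /= !mulr_sumr; apply: eq_bigr => c _.
by rewrite -strict_sum_zhat_term ?circ_neq0 // zhat_term_comma.
Qed.

(** * Convergence of the truncated star sums *)

Lemma star_term_ge0 j a : 0 <= q ^+ j / qint q j ^+ a.
Proof.
case: j => [|j]; first by rewrite qint0 expr0 mul1r invr_ge0 exprn_ge0.
by rewrite divr_ge0 ?exprn_ge0 // ltW // qint_gt0.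
Qed.

(** Holds because [j] >= 1 for [j > 0]. *)
Lemma star_term_le j a : (0 < j)%N -> q ^+ j / qint q j ^+ a <= q ^+ j.
Proof.
case: j => // j _; rewrite ler_pdivrMr ?exprn_gt0 ?qint_gt0 //.
rewrite ler_peMr ?exprn_ge0 ?(ltW q_gt0) // exprn_ege1 //.
rewrite ler_pdivlMr ?subr_q_gt0 // mul1r lerB // exprS ler_piMr ?(ltW q_gt0) //.
by rewrite exprn_ile1 // ltW.
Qed.

Lemma star_sum_ge0 n w : 0 <= star_sum n w.
Proof.
elim: w n => //= a w IH n.
by apply: sumr_ge0 => j _; rewrite mulr_ge0 ?star_term_ge0.
Qed.

Lemma star_sum_nondecreasing w :
  {homo (fun n => star_sum n w) : m n / (m <= n)%N >-> m <= n}.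
Proof.
case: w => //= a w m n mn.
rewrite [leRHS](big_cat_nat _ (n := m.+1)) //= lerDl.
by apply: sumr_ge0 => j _; rewrite mulr_ge0 ?star_term_ge0 ?star_sum_ge0.
Qed.

(** By [star_term_le], each letter costs at most a geometric series, bounded by 1 / (1 - q). *)
Lemma star_sum_bounded n w : star_sum n w <= (1 - q)^-1 ^+ size w.
Proof.
have q1 := subr_q_gt0.
elim: w n => //= a w IH n; rewrite exprS.
apply: (@le_trans _ _ (\sum_(1 <= j < n.+1) q ^+ j * (1 - q)^-1 ^+ size w)).
  rewrite !big_nat; apply: ler_sum => j /andP[j0 _].
  by rewrite ler_pM ?star_term_ge0 ?star_sum_ge0 ?star_term_le.
rewrite -mulr_suml ler_wpM2r ?exprn_ge0 ?invr_ge0 ?(ltW q1) //.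
rewrite -[leRHS]mul1r ler_pdivlMr //.
have -> : (\sum_(1 <= j < n.+1) q ^+ j) * (1 - q) = q ^+ 1 - q ^+ n.+1.
  rewrite mulr_suml -[RHS]opprB -(telescope_sumr (GRing.exp q)) // -sumrN.
  by apply: eq_bigr => j _; rewrite exprS; ring.
by rewrite expr1 lerBlDr (le_trans (ltW q_lt1)) // lerDl exprn_ge0 // ltW.
Qed.

Lemma star_sum_cvg w : cvgn (fun n => star_sum n w).
Proof.
apply: nondecreasing_is_cvgn; first exact: star_sum_nondecreasing.
by exists ((1 - q)^-1 ^+ size w) => _ [n _ <-]; exact: star_sum_bounded.
Qed.

(** * Passage to the limit in T_n *)

Lemma qratio_ge0 n k : 0 <= qratio n k.
Proof.
apply: prodr_ge0 => i _; rewrite addnS divr_ge0 ?(ltW (subr_expq_gt0 _)) //.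
by rewrite subr_ge0 exprn_ile1 // ltW.
Qed.

Lemma qratio_le1 n k : qratio n k <= 1.
Proof.
apply: prodr_ile1 => i _; rewrite addnS.
have d0 := subr_expq_gt0 (n + i).
rewrite divr_ge0 ?(ltW d0) ?subr_ge0 ?exprn_ile1 ?(ltW q_gt0) ?(ltW q_lt1) //=.
by rewrite ler_pdivrMr // mul1r lerB // ler_wiXn2l ?(ltW q_gt0) ?(ltW q_lt1) //; lia.
Qed.

Lemma qratio_cvg1 k : (fun n => qratio n k) @ \oo --> (1 : R).
Proof.
have qn : (GRing.exp q : R ^nat) @ \oo --> (0 : R).
  by apply: cvg_expr; rewrite ger0_norm // ltW.
have sub1 (h : R ^nat) : h @ \oo --> (0 : R) -> (fun n => 1 - h n) @ \oo --> (1 : R).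
  by move=> h0; rewrite -[X in _ --> X]subr0; apply: cvgB => //; exact: cvg_cst.
elim: k => [|k IH].
  by under eq_fun do rewrite qratio0; exact: cvg_cst.
have -> : (fun n => qratio n k.+1) =
    (fun n => qratio n k * ((1 - q ^+ (n - k)) / (1 - q ^+ (n + k.+1)))).
  by apply/funext => n; rewrite qratioS.
have one : 1 * (1 * 1^-1) = 1 :> R by rewrite invr1 !mulr1.
rewrite -[X in _ --> X]one.
apply: cvgM => //; apply: cvgM.
  by apply: (sub1 (fun n => q ^+ (n - k))); rewrite (cvg_centern k (GRing.exp q)).
apply: cvgV; first exact: oner_neq0.
by apply: (sub1 (fun n => q ^+ (n + k.+1))); rewrite (cvg_shiftn k.+1 (GRing.exp q)).
Qed.

(** A squeeze: T_n f is at most the partial sum because A_n(k) <= 1, and every partial sum is at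
    most [L]. *)
Lemma cvg_qratio_sum f (L : R) : (forall k, 0 <= f k) ->
  (fun n => qratio_sum n f) @ \oo --> L ->
  (fun n => \sum_(k < n) q ^+ (k ^ 2) * f k) @ \oo --> L.
Proof.
move=> f0 wL; pose g k := q ^+ (k ^ 2) * f k.
have g0 k : 0 <= g k by rewrite mulr_ge0 // exprn_ge0 // ltW.
(* For fixed [N], the first [N] terms of T_n f tend to this partial sum and, by nonnegativity, never
   exceed T_n f once [n >= N]. *)
have u_le N : \sum_(k < N) g k <= L.
  have cN : (fun n => \sum_(k < N) qratio n k * g k) @ \oo --> (\sum_(k < N) g k : R).
    apply: cvg_big => [|k _]; first exact: add_continuous.
    by rewrite -[X in _ --> X]mul1r; apply: cvgMr_tmp; exact: qratio_cvg1.
  apply: (ler_cvg_to cN wL); exists N => // n /= Nn.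
  rewrite /qratio_sum -(big_mkord xpredT (fun k => qratio n k * g k)).
  rewrite -(big_mkord xpredT (fun k => qratio n k * q ^+ (k ^ 2) * f k)).
  rewrite [leRHS](big_cat_nat _ (n := N)) ?(leq_trans Nn) //=.
  under [in leRHS]eq_bigr do rewrite -mulrA.
  by rewrite lerDl sumr_ge0 // => k _; rewrite -mulrA mulr_ge0 ?qratio_ge0 ?g0.
rewrite -cvg_shiftS.
apply: (squeeze_cvgr _ wL (cvg_cst L)); apply: nearW => n.
rewrite u_le andbT; apply: ler_sum => k _.
by rewrite -mulrA ler_piMl ?g0 ?qratio_le1.
Qed.

Lemma zhat_coef_ge0 s k : 0 <= zhat_coef s k.
Proof.
elim: s k => [|x s IH] k /=; first exact: ler0n.
rewrite mulr_ge0 ?exprn_ge0 ?star_term_ge0 // /prepend1.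
have h := star_term_ge0 k 1; rewrite expr1 in h.
rewrite addr_ge0 // mulr_ge0 ?sumr_ge0 // mulrDl mul1r addr_ge0 //.
case: k {h} => [|k]; first by rewrite qint0 invr0.
by rewrite invr_ge0 ltW // qint_gt0.
Qed.

(** * Comparison with the sums in the extended reals *)

Lemma fsum_star n w :
  (\sum_(k \in [set k : (size w).-tuple nat |
              sorted geq k && all [pred x | 1 <= x <= n]%N k])
    (\prod_(j < size w) (q ^+ tnth k j / qint q (tnth k j) ^+ nth 0%N w j))%:E)%E
  = (star_sum n w)%:E.
Proof.
pose e (k : (size w).-tuple 'I_n.+1) := map_tuple val k.
pose P := [pred k : (size w).-tuple 'I_n.+1 |
  sorted geq (map val k) && all [pred x | 1 <= x <= n]%N (map val k)].
rewrite (reindex_fsbig e [set` P]).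
  rewrite -(@bigfs _ _ _ _ (index_enum _)) ?index_enum_uniq //; last first.
    by move=> k _; rewrite mem_index_enum.
  rewrite sumEFin -(star_sumE w (ltnSn n)); congr EFin.
  by apply: eq_bigr => k _; apply: eq_bigr => j _; rewrite tnth_map.
split => //.
- by move=> k l _ _ /(congr1 val) /= /(inj_map val_inj) kl; apply/val_inj.
(* Surjectivity: entries are at most [n], so [inord] lifts them without loss. *)
- move=> k /= /andP[sk ak].
  have kn : all (fun x => x < n.+1)%N k by apply: sub_all ak => x /= /andP[].
  have ek : map val (map (inord : nat -> 'I_n.+1) k) = k.
    rewrite -map_comp -[RHS]map_id; apply/eq_in_map => x xk /=.
    by rewrite inordK // (allP kn).
  exists (map_tuple inord k); last by apply/val_inj; rewrite /= ek.
  by rewrite /= inE /= ek sk ak.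
Qed.

(** The unordered sum is a supremum over finite sets of tuples. The sets [D n] are among these, and
    each such set lies inside some [D n]. *)
Lemma zeta_starE w (L : R) : (fun n => star_sum n w) @ \oo --> L ->
  zeta_star q w = L%:E.
Proof.
move=> cL; rewrite /zeta_star.
pose D n := [set k : (size w).-tuple nat |
              sorted geq k && all [pred x | 1 <= x <= n]%N k].
have finD n : finite_set (D n).
  apply: (sub_finite_set (B := [set map_tuple val k
            | k in [set: (size w).-tuple 'I_n.+1]])); last first.
    exact/finite_image/finite_finset.
  move=> k /= /andP[_ ak]; exists (map_tuple inord k) => //.
  apply/val_inj; rewrite /= -map_comp -[RHS]map_id; apply/eq_in_map => x xk /=.
  by rewrite inordK //; have /andP[] := allP ak _ xk.
pose a (k : (size w).-tuple nat) :=
  (\prod_(j < size w) (q ^+ tnth k j / qint q (tnth k j) ^+ nth 0%N w j))%:E.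
have a0 (k : (size w).-tuple nat) : (0 <= a k)%E.
  by rewrite lee_fin; apply: prodr_ge0 => j _; exact: star_term_ge0.
apply/eqP; rewrite eq_le; apply/andP; split.
  apply: ge_ereal_sup => _ [X [finX XD] <-].
  have [A XA] := finite_fsetP.1 finX.
  (* The total of all entries of all tuples in [X] bounds each single entry. *)
  pose n := (\sum_(k <- finmap.enum_fset A) sumn k)%N.
  apply: (@le_trans _ _ (star_sum n w)%:E); last first.
    rewrite lee_fin -(cvg_lim _ cL) //.
    have := nondecreasing_cvgn_le (@star_sum_nondecreasing w) (@star_sum_cvg w) n.
    exact.
  rewrite -fsum_star; apply: (lee_fsum_nneg_subset finX (finD n)) => k;
    last by rewrite a0.
  move=> /set_mem kX; apply/mem_set; have /andP[sk ak] := XD _ kX.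
  apply/andP; split=> //; apply/allP => x xk /=; have /= -> := allP ak _ xk.
  have kA : k \in finmap.enum_fset A by move: kX; rewrite XA.
  apply: (@leq_trans (sumn k)).
    rewrite sumnE (big_rem x) //=; exact: leq_addr.
  by rewrite /n (big_rem k) //=; exact: leq_addr.
have cE : (fun n => (star_sum n w)%:E) @ \oo --> L%:E.
  by apply: cvg_EFin => //; exact: nearW.
rewrite -(cvg_lim _ cE) //; apply: lime_le; first by apply/cvg_ex; exists L%:E.
apply: nearW => n; rewrite -fsum_star; apply: esum_ge.
exists (D n) => //; split => // k /= /andP[-> ak] /=.
by apply: sub_all ak => x /= /andP[].
Qed.

Lemma zhatE u v : u != [::] ->
  zhat q u v = (\sum_(1 <= k <oo) (q ^+ (k ^ 2) * zhat_term k u v)%:E)%E.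
Proof.
move=> u0; rewrite /zhat; apply/congr_lim/funext => n; apply: eq_big_nat.
(* For a positive index, the predecessor passed to [H] cancels the successor in [H_strict_sum]. *)
move=> [|k] // _; congr EFin.
by rewrite H_strict_sum /zhat_term expfzDr ?gt_eqF // -exprnP -!mulrA.
Qed.

Lemma zhat_term_ge0 k u v : 0 <= zhat_term k u v.
Proof.
have Q0 j : 0 <= qint q j.
  by case: j => [|j]; rewrite ?qint0 // ltW // qint_gt0.
have F0 j (a b : int) : 0 <= q ^ a * (1 + q ^+ j) / qint q j ^ b.
  by rewrite divr_ge0 ?mulr_ge0 ?addr_ge0 ?exprz_ge0 ?exprn_ge0 // ltW.
have S0 j l l' : 0 <= strict_sum j l l'.
  by elim: l j l' => //= a l IH j l'; apply: sumr_ge0 => i _; rewrite mulr_ge0.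
by rewrite /zhat_term mulr_ge0.
Qed.

(** A common real value [L] yields finiteness and equality together. *)
Lemma zeta_star_zhat_cons x s : exists L : R,
  zeta_star q (flatten [seq rcons (nseq i 2%N) 1%N | i <- x :: s]) = L%:E /\
  (\sum_(c : (size s).-tuple bool)
     zhat q (circ c [seq (2 * i + 1)%N%:Z | i <- x :: s])
            (circ c [seq (i + 1)%N%:Z | i <- x :: s]))%E = L%:E.
Proof.
set w := flatten _.
exists (limn (fun n => star_sum n w)).
have cL := star_sum_cvg (w := w); split; first exact: zeta_starE.
under eq_bigr => c _ do rewrite zhatE ?circ_neq0 //.
(* Nonnegative terms allow the finite sum over choices to move inside the series. *)
rewrite -nneseries_sum; last first.
  by move=> c k _; rewrite lee_fin mulr_ge0 ?zhat_term_ge0 // exprn_ge0 // ltW.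
have {}cL : (fun n => qratio_sum n (zhat_coef (x :: s))) @ \oo
    --> limn (fun n => star_sum n w).
  by under eq_fun do rewrite -star_sum_qratio_sum //; exact: cL.
have cL' := cvg_qratio_sum (zhat_coef_ge0 _) cL.
apply: cvg_lim => //.
rewrite (_ : (fun n => _) =
    fun n => (\sum_(k < n) q ^+ (k ^ 2) * zhat_coef (x :: s) k)%:E).
  by apply: cvg_EFin => //; exact: nearW.
apply/funext => n.
rewrite -(@sum_nat1_ord n (fun k => q ^+ (k ^ 2) * zhat_coef (x :: s) k)); last first.
  by rewrite zhat_coef_cons0 mulr0.
under eq_bigr do rewrite sumEFin.
rewrite sumEFin; congr EFin; apply: eq_big_nat => k /andP[k0 _].
by rewrite zhat_coefE // mulr_sumr.
Qed.

End QSums.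

Theorem theorem1p1 (R : realType) (q : R) (hq0 : 0 < q) (hq1 : q < 1)
  (m : nat) (hm : (1 <= m)%N) (s : m.-tuple nat) :
  let lhs := zeta_star q (flatten [seq rcons (nseq i 2%N) 1%N | i <- s]) in
  lhs \is a fin_num /\
  lhs = (\sum_(c : (m.-1).-tuple bool)
           zhat q (circ c [seq (2 * i + 1)%N%:Z | i <- s])
                  (circ c [seq (i + 1)%N%:Z | i <- s]))%E.
Proof.
case: s => -[|x s] sm; have em := eqP sm; first by rewrite -em in hm.
by subst m; have [L [/= -> ->]] := zeta_star_zhat_cons hq0 hq1 x s.
Qed.
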